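(* Define integers $b_{\mathcal{M}}(n)$, $n\ge0$, by $b_{\mathcal{M}}(0)=1$, $b_{\mathcal{M}}(1)=-1$, $b_{\mathcal{M}}(2)=0$ and, for $n\ge 3$, $$b_{\mathcal{M}}(n)=-\frac{1}{2}\sum_{k=0}^{n-1}b_{\mathcal{M}}(k)\binom{n+1}{k+1}.$$ Let $G(x)=-x\frac{e^x-1}{e^x+1}$. Then $b_{\mathcal{M}}(2n-1)=G^{(2n)}(0)$ for all $n\ge 1$. *)

(* Defs.v *)
From Stdlib Require Import Reals Lra Lia Arith.
From Coquelicot Require Import Coquelicot.
Open Scope R_scope.

(* [Binomial.C] is the real-valued binomial coefficient; plain [C] is
   Coquelicot's type of complex numbers. *)
Definition bM_step (b : nat -> R) (n : nat) : R :=
  - (1 / 2) * sum_f_R0 (fun k => b k * Binomial.C (n + 1) (k + 1)) (n - 1).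

Definition is_bM (b : nat -> R) : Prop :=
  b 0%nat = 1 /\ b 1%nat = -1 /\ b 2%nat = 0 /\
  forall n : nat, (3 <= n)%nat -> b n = bM_step b n.

Definition G (x : R) : R := - x * ((exp x - 1) / (exp x + 1)).

(* [bM_table N] is correct at the indices up to [N + 2]. *)
Fixpoint bM_table (N : nat) : nat -> R :=
  match N with
  | O => fun n => match n with O => 1 | 1%nat => -1 | _ => 0 end
  | S N' => fun n =>
      if Nat.eqb n (N' + 3) then bM_step (bM_table N') n else bM_table N' n
  end.

Lemma bM_table_stable (m n d : nat) :
  (n <= m + 2)%nat -> bM_table (d + m) n = bM_table m n.
Proof.
  intros H; induction d as [|d IH]; [reflexivity|].
  simpl; destruct (Nat.eqb_spec n (d + m + 3)); [lia|exact IH].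
Qed.

Lemma is_bM_exists : exists b : nat -> R, is_bM b.
Proof.
  exists (fun n => bM_table n n).
  split; [reflexivity|]. split; [reflexivity|]. split; [reflexivity|].
  intros n Hn.
  destruct n as [|[|[|m]]]; try lia.
  replace (S (S (S m))) with (2 + S m)%nat at 1 by lia.
  rewrite bM_table_stable by lia.
  cbn [bM_table].
  destruct (Nat.eqb_spec (S (S (S m))) (m + 3)); [|lia].
  unfold bM_step; f_equal. apply sum_eq; intros k Hk; f_equal.
  destruct (Nat.le_gt_cases m k).
  - replace k with ((k - m) + m)%nat at 2 by lia.
    rewrite bM_table_stable by lia; reflexivity.
  - replace m with ((m - k) + k)%nat by lia.
    apply bM_table_stable; lia.
Qed.

Lemma is_bM_unique (b c : nat -> R) :
  is_bM b -> is_bM c -> forall n : nat, b n = c n.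
Proof.
  intros [b0 [b1 [b2 Hb]]] [c0 [c1 [c2 Hc]]] n.
  induction n as [n IH] using lt_wf_ind.
  destruct n as [|[|[|m]]]; try congruence.
  rewrite Hb, Hc by lia; unfold bM_step; f_equal.
  apply sum_eq; intros k Hk; rewrite IH by lia; reflexivity.
Qed.

(* Main.v *)
Require Import Defs.
From Stdlib Require Import Reals Lra Lia Arith.
From Coquelicot Require Import Coquelicot.
Open Scope R_scope.

(** Put [F x = 2 x / (exp x + 1)], so that [G x = F x - x], and let [c n] be
    the [n]-th derivative of [F] at [0].  Differentiating [exp x * F x + F x = 2 x]
    gives [sum_k C(n,k) c_k + c_n = 0] for [n >= 2], which is the recurrence of
    [b] with [b n = c (n + 1)].

    For integrality, let [L] be the linear functional [x^n |-> c n] on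
    polynomials, so that [L (p (x+1) + p x) = 2 p'(0)].  For [n >= 2] the choice
    [p = x^n (x-1)^n] gives [L (x^n ((x+1)^n + (x-1)^n)) = 0]; the argument is
    twice a monic integral polynomial of degree [2 n], hence [c (2 n)] is an
    integral combination of smaller [c k].  The odd [c n], [n >= 3], vanish since
    [G] is even. *)

(** * Derivative sequences *)

(** Carries a smooth function together with all its derivatives, so that an identity at order 0
    passes to every order. *)
Definition derivative_seq (u : nat -> R -> R) : Prop :=
  forall (n : nat) (x : R), is_derive (u n) x (u (S n) x).

Lemma derivative_seq_Derive_n (u : nat -> R -> R) (n : nat) (x : R) :
  derivative_seq u -> Derive_n (u 0%nat) n x = u n x.
Proof.
  intros Hu; revert x; induction n as [|n IH]; intros x; [reflexivity|].
  simpl; rewrite (Derive_ext _ (u n) x IH).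
  now apply is_derive_unique.
Qed.

Lemma derivative_seq_ext (u v : nat -> R -> R) :
  derivative_seq u -> derivative_seq v ->
  (forall x, u 0%nat x = v 0%nat x) -> forall n x, u n x = v n x.
Proof.
  intros Hu Hv H0 n x.
  rewrite <- (derivative_seq_Derive_n u), <- (derivative_seq_Derive_n v) by assumption.
  now apply Derive_n_ext.
Qed.

Definition linear_seq (a : R) (n : nat) (x : R) : R :=
  match n with O => a * x | S O => a | _ => 0 end.

Lemma derivative_seq_linear (a : R) : derivative_seq (linear_seq a).
Proof.
  intros [|[|n]] x; simpl; [|apply (is_derive_const (V := R_NormedModule))..].
  rewrite <- (Rmult_1_r a) at 2.
  apply (is_derive_scal (fun y => y)), (is_derive_id (K := R_AbsRing)).
Qed.

Lemma derivative_seq_plus (u v : nat -> R -> R) :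
  derivative_seq u -> derivative_seq v ->
  derivative_seq (fun n x => u n x + v n x).
Proof. intros Hu Hv n x; exact (is_derive_plus _ _ _ _ _ (Hu n x) (Hv n x)). Qed.

Lemma derivative_seq_comp_opp (u : nat -> R -> R) :
  derivative_seq u -> derivative_seq (fun n x => (-1) ^ n * u n (- x)).
Proof.
  intros Hu n x.
  replace ((-1) ^ S n * u (S n) (- x))
    with ((-1) ^ n * (-1 * u (S n) (- x))) by (simpl; ring).
  apply (is_derive_scal (fun y => u n (- y))).
  apply (is_derive_comp (u n) Ropp x); [apply Hu|].
  auto_derive; trivial.
Qed.

(** * Binomial transforms *)

(* In umbral notation, with [c n] for [x^n], these are [x^i (x+1)^j] and
   [x^i (x-1)^j]. *)
Fixpoint binomial_plus (c : nat -> R) (j i : nat) : R :=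
  match j with
  | O => c i
  | S j' => binomial_plus c j' i + binomial_plus c j' (S i)
  end.

Fixpoint binomial_minus (c : nat -> R) (j i : nat) : R :=
  match j with
  | O => c i
  | S j' => binomial_minus c j' (S i) - binomial_minus c j' i
  end.

Lemma binomial_n_0 (n : nat) : Binomial.C n 0 = 1.
Proof.
  unfold Binomial.C; rewrite Nat.sub_0_r; simpl; field; apply INR_fact_neq_0.
Qed.

Lemma binomial_n_n (n : nat) : Binomial.C n n = 1.
Proof. rewrite pascal_step1, Nat.sub_diag by lia; apply binomial_n_0. Qed.

Lemma binomial_plus_sum (c : nat -> R) (j i : nat) :
  binomial_plus c j i = sum_f_R0 (fun k => Binomial.C j k * c (i + k)%nat) j.
Proof.
  revert i; induction j as [|j IH]; intros i; simpl binomial_plus.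
  - simpl; rewrite binomial_n_0, Nat.add_0_r; ring.
  (* Both end terms are split off because [pascal] covers only interior indices:
     [Binomial.C n (S n)] is 1 / (n + 1), not 0. *)
  - rewrite !IH, (decomp_sum _ (S j)) by lia.
    simpl pred.
    destruct j as [|j].
    { simpl; rewrite !binomial_n_0, !binomial_n_n, !Nat.add_0_r, Nat.add_1_r; ring. }
    rewrite (decomp_sum _ (S j)) by lia; simpl pred.
    rewrite 2!tech5, !binomial_n_0, !binomial_n_n.
    rewrite (sum_eq (fun k => Binomial.C (S (S j)) (S k) * c (i + S k)%nat)
      (fun k => Binomial.C (S j) (S k) * c (i + S k)%nat
                + Binomial.C (S j) k * c (S i + k)%nat)).
    + rewrite sum_plus.
      replace (S i + S j)%nat with (i + S (S j))%nat by lia.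
      ring.
    + intros k Hk; rewrite <- pascal by lia.
      replace (S i + k)%nat with (i + S k)%nat by lia; ring.
Qed.

(** Leibniz's rule in the form D^n (exp u) = exp (1 + D)^n u: each step of [binomial_plus] applies 1
    + D. *)
Lemma derivative_seq_exp_mult (u : nat -> R -> R) :
  derivative_seq u ->
  derivative_seq (fun n x => exp x * binomial_plus (fun k => u k x) n 0).
Proof.
  intros Hu n x.
  assert (H : forall j i, is_derive (fun y => binomial_plus (fun k => u k y) j i) x
                            (binomial_plus (fun k => u k x) j (S i))).
  { induction j as [|j IH]; intros i; [apply Hu|].
    exact (is_derive_plus _ _ _ _ _ (IH i) (IH (S i))). }
  simpl binomial_plus; rewrite Rmult_plus_distr_l.
  apply (is_derive_mult exp); [apply is_derive_exp | apply H | apply Rmult_comm].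
Qed.

(** * Integrality *)

Definition is_integer (x : R) : Prop := exists z : Z, x = IZR z.

Lemma is_integer_plus (x y : R) : is_integer x -> is_integer y -> is_integer (x + y).
Proof. intros [a ->] [b ->]; exists (a + b)%Z; symmetry; apply plus_IZR. Qed.

Lemma is_integer_opp (x : R) : is_integer x -> is_integer (- x).
Proof. intros [a ->]; exists (- a)%Z; symmetry; apply opp_IZR. Qed.

(* [L (p (x+1) + p x) = 0] for [p = x^j (x-1)^i]. *)
Lemma binomial_plus_minus_reflection (c : nat -> R) :
  (forall j, (2 <= j)%nat -> binomial_plus c j 0 + c j = 0) ->
  forall i j, (2 <= j)%nat -> binomial_plus c j i + binomial_minus c i j = 0.
Proof.
  intros Hc i; induction i as [|i IH]; intros j Hj; [now apply Hc|].
  (* The instance at [S j] minus the one at [j]: the factor (x + 1) - 1 is x in the first term, and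
     x - 1 in the second. *)
  generalize (IH j Hj) (IH (S j) ltac:(lia)); simpl; lra.
Qed.

(** Let s and d be half the sum and half the difference of (x+1)^j and (x-1)^j. Passing to j + 1
    replaces them by x s + d and x d + s, so both stay integral, s is monic of degree j and d has
    smaller degree. The leading term of x^i s is subtracted because its index may be [N]. *)
Lemma binomial_half_sum_integer (c : nat -> R) (N : nat) :
  (forall k, (k < N)%nat -> is_integer (c k)) ->
  forall j i, (i + j <= N)%nat ->
    is_integer ((binomial_plus c j i + binomial_minus c j i) / 2 - c (i + j)%nat) /\
    is_integer ((binomial_plus c j i - binomial_minus c j i) / 2).
Proof.
  intros Hc j; induction j as [|j IH]; intros i Hi.
  - simpl; rewrite Nat.add_0_r; split; exists 0%Z; field.
  - destruct (IH i ltac:(lia)) as [Hs Hd], (IH (S i) ltac:(lia)) as [Hs' Hd'].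
    pose proof (Hc (i + j)%nat ltac:(lia)) as Hij.
    simpl; replace (i + S j)%nat with (S i + j)%nat by lia; split.
    + eapply eq_ind; [exact (is_integer_plus _ _ Hs' Hd) | field].
    + eapply eq_ind;
        [exact (is_integer_plus _ _ (is_integer_plus _ _ Hs Hij) Hd') | field].
Qed.

Lemma binomial_recurrence_integer (c : nat -> R) :
  is_integer (c 0%nat) -> is_integer (c 1%nat) -> is_integer (c 2%nat) ->
  (forall n, c (2 * n + 3)%nat = 0) ->
  (forall j, (2 <= j)%nat -> binomial_plus c j 0 + c j = 0) ->
  forall n, is_integer (c n).
Proof.
  intros H0 H1 H2 Hodd Hc n; induction n as [n IH] using lt_wf_ind.
  destruct n as [|[|[|n]]]; trivial.
  destruct (Nat.Even_or_Odd n) as [[m Hm]|[m Hm]].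
  - replace (S (S (S n))) with (2 * m + 3)%nat by lia.
    rewrite Hodd; now exists 0%Z.
  - replace (S (S (S n))) with (S (S m) + S (S m))%nat in * by lia.
    (* With both exponents equal to m + 2, the reflection makes the half sum vanish and leaves only
       the negated leading term. *)
    destruct (binomial_half_sum_integer c _ IH (S (S m)) (S (S m)) (le_n _)) as [H _].
    rewrite binomial_plus_minus_reflection in H by (trivial; lia).
    eapply eq_ind; [exact (is_integer_opp _ H) | field].
Qed.

(** * The generating function *)

(** The exponential generating function of the Genocchi numbers, written as a product to match the
    constructors of [logistic_poly]. *)
Definition F (x : R) : R := 2 * x * / (exp x + 1).

Lemma exp_plus_1_neq_0 (x : R) : exp x + 1 <> 0.
Proof. generalize (exp_pos x); lra. Qed.

(* Closed under differentiation because [s = 1 / (exp x + 1)] satisfies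
   [s' = s^2 - s]. *)
Inductive logistic_poly : (R -> R) -> Prop :=
| lp_const a : logistic_poly (fun _ => a)
| lp_id : logistic_poly (fun x => x)
| lp_logistic : logistic_poly (fun x => / (exp x + 1))
| lp_plus f g : logistic_poly f -> logistic_poly g -> logistic_poly (fun x => f x + g x)
| lp_mult f g : logistic_poly f -> logistic_poly g -> logistic_poly (fun x => f x * g x).

Lemma logistic_poly_derive (f : R -> R) :
  logistic_poly f -> exists g, logistic_poly g /\ forall x, is_derive f x (g x).
Proof.
  induction 1 as [a| | |f g Hf [f' [Kf Df]] Hg [g' [Kg Dg]]
                       |f g Hf [f' [Kf Df]] Hg [g' [Kg Dg]]].
  - exists (fun _ => 0); split; [constructor|].
    intros x; apply (is_derive_const (V := R_NormedModule)).
  - exists (fun _ => 1); split; [constructor|].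
    intros x; apply (is_derive_id (K := R_AbsRing)).
  - exists (fun x => / (exp x + 1) * / (exp x + 1) + (-1) * / (exp x + 1)).
    split; [repeat constructor|]; intros x; pose proof (exp_plus_1_neq_0 x).
    auto_derive; trivial; field; trivial.
  - exists (fun x => f' x + g' x); split; [now constructor|]; intros x.
    exact (is_derive_plus _ _ _ _ _ (Df x) (Dg x)).
  - exists (fun x => f' x * g x + f x * g' x); split; [now repeat constructor|]; intros x.
    exact (is_derive_mult f g x _ _ (Df x) (Dg x) Rmult_comm).
Qed.

(** [Derive_n] is total, so differentiability must be shown at each order; it holds because every
    iterated derivative stays in the class. *)
Lemma logistic_poly_derivative_seq (f : R -> R) :
  logistic_poly f -> derivative_seq (Derive_n f).
Proof.
  intros Hf n.
  assert (H : exists g, logistic_poly g /\ forall x, Derive_n f n x = g x).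
  { induction n as [|n [g [Kg Eg]]]; [now exists f|].
    destruct (logistic_poly_derive g Kg) as [g' [Kg' Dg]].
    exists g'; split; trivial; intros x; simpl.
    rewrite (Derive_ext _ g x Eg); now apply is_derive_unique. }
  destruct H as [g [Kg Eg]], (logistic_poly_derive g Kg) as [g' [_ Dg]].
  intros x; simpl; apply Derive_correct; exists (g' x).
  apply (is_derive_ext g); [intros t; symmetry; apply Eg | apply Dg].
Qed.

Lemma derivative_seq_F : derivative_seq (Derive_n F).
Proof. apply logistic_poly_derivative_seq; repeat constructor. Qed.

Lemma F_derivatives_recurrence (n : nat) :
  binomial_plus (fun k => Derive_n F k 0) n 0 + Derive_n F n 0 = linear_seq 2 n 0.
Proof.
  rewrite <- (derivative_seq_ext
    (fun n x => exp x * binomial_plus (fun k => Derive_n F k x) n 0 + Derive_n F n x)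
    (linear_seq 2)).
  - rewrite exp_0; ring.
  - apply derivative_seq_plus; [apply derivative_seq_exp_mult|]; apply derivative_seq_F.
  - apply derivative_seq_linear.
  - intros x; simpl; unfold F; field; apply exp_plus_1_neq_0.
Qed.

(** From [F (- x) = F x - 2 * x]: at odd order at least 3 the linear term is gone and the derivative
    at 0 equals its own negative. *)
Lemma F_derivatives_odd (n : nat) : Derive_n F (2 * n + 3) 0 = 0.
Proof.
  assert (H : (-1) ^ (2 * n + 3) * Derive_n F (2 * n + 3) (- 0)
              = Derive_n F (2 * n + 3) 0 + linear_seq (-2) (2 * n + 3) 0).
  { apply (derivative_seq_ext
      (fun n x => (-1) ^ n * Derive_n F n (- x))
      (fun n x => Derive_n F n x + linear_seq (-2) n x)).
    - apply derivative_seq_comp_opp, derivative_seq_F.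
    - apply derivative_seq_plus; [apply derivative_seq_F | apply derivative_seq_linear].
    - intros x; simpl; unfold F; rewrite exp_Ropp.
      pose proof (exp_pos x); field; lra. }
  replace (2 * n + 3)%nat with (S (2 * S n)) in * by lia.
  rewrite Ropp_0, pow_1_odd in H.
  replace (linear_seq (-2) (S (2 * S n)) 0) with 0 in H
    by (replace (2 * S n)%nat with (S (S (2 * n))) by lia; reflexivity).
  lra.
Qed.

Lemma F_derivatives_is_bM : is_bM (fun n => Derive_n F (S n) 0).
Proof.
  assert (H0 : Derive_n F 0 0 = 0) by (simpl; unfold F; ring).
  pose proof (F_derivatives_recurrence 1) as H1.
  pose proof (F_derivatives_recurrence 2) as H2.
  pose proof (F_derivatives_odd 0) as H3; simpl Nat.add in H3; simpl Nat.mul in H3.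
  cbn [binomial_plus linear_seq] in H1, H2.
  repeat split; [lra | lra | exact H3 |].
  (* At order n + 1 the first term vanishes, and the last one doubles the added derivative, whence
     the factor 1/2 in [bM_step]. *)
  intros n Hn; pose proof (F_derivatives_recurrence (S n)) as H.
  rewrite binomial_plus_sum, (decomp_sum _ (S n)) in H by lia.
  destruct n as [|[|n]]; try lia.
  simpl pred in H; rewrite tech5 in H; unfold bM_step.
  rewrite (sum_eq _ (fun k => Binomial.C (S (S (S n))) (S k) * Derive_n F (0 + S k) 0)).
  2:{ intros k _; rewrite !Nat.add_1_r; apply Rmult_comm. }
  replace (S (S n) - 1)%nat with (S n) by lia.
  cbn [linear_seq Nat.add] in H |- *.
  rewrite H0, binomial_n_0, binomial_n_n in H; lra.
Qed.

Lemma Derive_n_G (n : nat) (x : R) :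
  Derive_n G n x = Derive_n F n x + linear_seq (-1) n x.
Proof.
  rewrite <- (derivative_seq_Derive_n
    (fun n x => Derive_n F n x + linear_seq (-1) n x)).
  - apply Derive_n_ext; intros t; simpl; unfold G, F.
    field; apply exp_plus_1_neq_0.
  - apply derivative_seq_plus; [apply derivative_seq_F | apply derivative_seq_linear].
Qed.

Theorem mainTheorem6 (b : nat -> R) (hb : is_bM b) :
  (forall n : nat, exists z : Z, b n = IZR z) /\
  (forall n : nat, (1 <= n)%nat -> b (2 * n - 1)%nat = Derive_n G (2 * n) 0).
Proof.
  pose proof (is_bM_unique _ _ hb F_derivatives_is_bM) as Hb; cbv beta in Hb.
  destruct hb as [b0 [b1 _]]; split.
  - intros n; rewrite Hb.
    apply (binomial_recurrence_integer (fun k => Derive_n F k 0)).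
    + exists 0%Z; simpl; unfold F; ring.
    + exists 1%Z; rewrite <- Hb; exact b0.
    + exists (-1)%Z; rewrite <- Hb; exact b1.
    + exact F_derivatives_odd.
    + intros [|[|j]] Hj; try lia.
      exact (F_derivatives_recurrence (S (S j))).
  - intros [|n] Hn; [lia|].
    (* [G] and [F] differ by a linear term, invisible at order at least 2. *)
    rewrite Hb, Derive_n_G.
    replace (S (2 * S n - 1)) with (S (S (2 * n))) by lia.
    replace (2 * S n)%nat with (S (S (2 * n))) by lia.
    simpl linear_seq; ring.
Qed.
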